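(* Let $K$ be a field, let $G$ be a finite graph with edge set $E$ and vertex set $V$, with a fixed orientation of the edges, and let $p\in K^{V,0}$ be a nonzero momentum of $G$. Then the second graph polynomial $$\Phi_G(p,A)=\sum_{F}s_F(p)\prod_{e\notin F}A_e\qquad(\text{sum over the quasi-spanning forests }F\text{ of }G)$$ is a configuration polynomial for the configuration $H_1(G,p)\subseteq K^E$. Moreover, $\Phi_G(p,A)$ equals the configuration determinant of $H_1(G,p)$ computed in any basis of $H_1(G,p)$ consisting of an integral basis of $H_1(G)$ (i.e. a basis of $H_1(G,\mathbb{Z})$) together with an element $q\in K^E$ such that $\partial q=p$.
   Context: Graphs are undirected multigraphs (loops and multiple edges allowed, not necessarily connected). Subgraphs such as forests below contain all vertices of $G$ and are identified with their edge sets. A spanning forest of $G$ is a forest whose components are spanning trees of the components of $G$. A quasi-spanning forest is a spanning forest with one edge removed (all vertices are kept); it has exactly two components $T_1,T_2$ that are not spanning trees of components of $G$. A momentum is an element of $K^{V,0}=\{p\in K^V: \sum_{v\in V(G_\alpha)}p_v=0$ for every connected component $G_\alpha$ of $G\}$. For a quasi-spanning forest $F$ with exceptional components $T_1,T_2$, put $m_{T_i}(p)=\sum_{v\in V(T_i)}p_v$; then $m_{T_1}(p)=-m_{T_2}(p)$ and $s_F(p)=m_{T_1}(p)^2=m_{T_2}(p)^2$. An orientation assigns to each edge $e$ its endpoints $h(e),t(e)$; $\partial:\mathbb{Z}^E\to\mathbb{Z}^V$, $\partial(e)=h(e)-t(e)$, also denotes its extension $K^E\to K^V$, whose image is $K^{V,0}$.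 $H_1(G,\mathbb{Z})=\ker(\partial:\mathbb Z^E\to\mathbb Z^V)$, $H_1(G)=\ker(\partial:K^E\to K^V)=H_1(G,\mathbb{Z})\otimes K$. For $p\neq0$, $H_1(G,p)=\partial^{-1}(Kp)=H_1(G)\oplus Kq$ for any $q$ with $\partial q=p$. A configuration is a linear subspace $W\subseteq K^E$. With $X_e:K^E\to K$ the coordinate functions and $A_e$ variables, the configuration determinant of a nonzero $W$ in a basis $w_1,\dots,w_\ell$ is $\det\big(\sum_{e\in E}A_eX_e(w_i)X_e(w_j)\big)_{i,j}\in K[A_e:e\in E]$; a configuration polynomial of $W$ is any generator of the principal ideal generated by this determinant (i.e. any nonzero scalar multiple of it). *)

(* Defs.v *)
From HB Require Import structures.
From mathcomp Require Import all_boot all_order all_algebra.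
From mathcomp Require Import mpoly.

Set Implicit Arguments.
Unset Strict Implicit.
Unset Printing Implicit Defensive.

Import GRing.Theory.
Local Open Scope ring_scope.

(* Undirected multigraph: a loop has one end, any other edge has two. *)
Record mgraph := MGraph {
  vertex : finType;
  edge : finType;
  ends : edge -> {set vertex};
  _ : forall e, (0 < #|ends e| <= 2)%N }.

Section Forests.

Variable G : mgraph.
Local Notation V := (vertex G).
Local Notation E := (edge G).

Definition adj (F : {set E}) : rel V :=
  fun u v => [exists e in F, ends e == [set u; v]].

Definition component (F : {set E}) (v : V) : {set V} :=
  [set u | connect (adj F) v u].

Definition components (F : {set E}) : {set {set V}} :=
  [set component F v | v : V].

(* The cycle v_1 -e_1- v_2 -e_2- ... v_n -e_n- v_1 is encoded as the sequence
   (v_1, e_1), ..., (v_n, e_n). A loop is a cycle of length 1, and two parallel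
   edges form a cycle of length 2. *)
Definition graph_cycle (F : {set E}) (c : seq (V * E)) : bool :=
  [&& c != [::], uniq (unzip1 c), uniq (unzip2 c),
      all [pred x | x.2 \in F] c
    & cycle [rel x y | ends x.2 == [set x.1; y.1]] c].

(* The edges of a cycle are distinct, so its length is at most #|E|. *)
Definition forest (F : {set E}) : bool :=
  [forall n : 'I_#|E|, forall c : n.+1.-tuple (V * E), ~~ graph_cycle F c].

Lemma forestP (F : {set E}) :
  reflect (forall c, ~~ graph_cycle F c) (forest F).
Proof.
apply: (iffP forallP) => [H c | H n]; last by apply/forallP => c; apply: H.
apply/negP => Hc; have [c0 _ uc _ _] := and5P Hc.
have le_c : (size c <= #|E|)%N.
  by rewrite -(size_map snd) -(card_uniqP uc) max_card.
have sc : size c = (size c).-1.+1 by case: (c) c0.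
have lt_c : ((size c).-1 < #|E|)%N by rewrite -sc.
have /forallP/(_ (tcast sc (in_tuple c))) := H (Ordinal lt_c).
by rewrite val_tcast /= Hc.
Qed.

Definition spanning_forest (F : {set E}) : bool :=
  forest F && (components F == components [set: E]).

Definition quasi_spanning_forest (F : {set E}) : bool :=
  [exists F' : {set E}, exists e in F', spanning_forest F' && (F == F' :\ e)].

(* The vertex sets of T_1 and T_2: a component of a forest is a spanning tree
   of a component of G iff the two have the same vertices. *)
Definition exceptional (F : {set E}) : {set {set V}} :=
  components F :\: components [set: E].

End Forests.

Section Momenta.

Variables (K : fieldType) (G : mgraph).
Local Notation V := (vertex G).
Local Notation E := (edge G).

Definition mass (p : {ffun V -> K^o}) (T : {set V}) : K := \sum_(v in T) p v.

Definition momentum (p : {ffun V -> K^o}) : Prop :=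
  forall T, T \in components [set: E] -> mass p T = 0.

(* For a momentum p and a quasi-spanning forest F, the two elements of
   [exceptional F] have opposite masses, so the choice is immaterial. *)
Definition sqmass (p : {ffun V -> K^o}) (F : {set E}) : K :=
  if [pick T in exceptional F] is Some T then mass p T ^+ 2 else 0.

(* The variable A_e is 'X_(enum_rank e). *)
Definition second_graph_poly (p : {ffun V -> K^o}) : {mpoly K[#|E|]} :=
  \sum_(F : {set E} | quasi_spanning_forest F)
     sqmass p F *: \prod_(e | e \notin F) 'X_(enum_rank e).

End Momenta.

Definition orientation (G : mgraph) (h t : edge G -> vertex G) : Prop :=
  forall e, ends e = [set h e; t e].

Definition boundary (R : pzRingType) (V E : finType) (h t : E -> V)
    (f : {ffun E -> R}) : {ffun V -> R} :=
  [ffun v => \sum_e f e * ((h e == v)%:R - (t e == v)%:R)].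

Section Homology.

Variables (K : fieldType) (V E : finType) (h t : E -> V).

Lemma boundary_is_linear :
  linear (boundary h t : {ffun E -> K^o} -> {ffun V -> K^o}).
Proof.
move=> a f g; apply/ffunP => v; rewrite !ffunE scaler_sumr -big_split /=.
by apply: eq_bigr => e _; rewrite !ffunE mulrDl scalerAl.
Qed.

HB.instance Definition _ :=
  GRing.isLinear.Build K {ffun E -> K^o} {ffun V -> K^o} *:%R
    (boundary h t : {ffun E -> K^o} -> {ffun V -> K^o}) boundary_is_linear.

(* H_1(G, p) *)
Definition relative_H1 (p : {ffun V -> K^o}) : {vspace {ffun E -> K^o}} :=
  (linfun (boundary h t : {ffun E -> K^o} -> {ffun V -> K^o}) @^-1: <[p]>)%VS.

Lemma relative_H1P (p : {ffun V -> K^o}) (f : {ffun E -> K^o}) :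
  reflect (exists a : K, boundary h t f = a *: p) (f \in relative_H1 p).
Proof. by rewrite -memv_preim lfunE; apply: vlineP. Qed.

(* Basis of the abelian group H_1(G, Z). *)
Definition integral_H1_basis (k : nat) (b : k.-tuple {ffun E -> int}) : Prop :=
  [/\ forall i, boundary h t (tnth b i) = 0,
      forall c : 'I_k -> int,
        \sum_i tnth b i *~ c i = 0 -> forall i, c i = 0
    & forall z : {ffun E -> int}, boundary h t z = 0 ->
        exists c : 'I_k -> int, z = \sum_i tnth b i *~ c i].

Definition of_integral (z : {ffun E -> int}) : {ffun E -> K^o} :=
  [ffun e => (z e)%:~R].

End Homology.

Section Configurations.

Variables (K : fieldType) (E : finType).

Definition config_det (w : seq {ffun E -> K^o}) : {mpoly K[#|E|]} :=
  \det (\matrix_(i < size w, j < size w)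
     \sum_e (w`_i e * w`_j e : K) *: 'X_(enum_rank e)).

(* P generates the principal ideal generated by the determinant. *)
Definition config_poly (W : {vspace {ffun E -> K^o}})
    (P : {mpoly K[#|E|]}) : Prop :=
  W != 0%VS /\
  forall w, basis_of W w ->
    forall Q, (exists a, Q = a * P) <-> (exists a, Q = a * config_det w).

End Configurations.

(* Main.v *)
Require Import Defs.
From HB Require Import structures.
From mathcomp Require Import all_boot all_order all_algebra.
From mathcomp Require Import perm mpoly.

Set Implicit Arguments.
Unset Strict Implicit.
Unset Printing Implicit Defensive.

Import GRing.Theory.
Local Open Scope ring_scope.

(* Expand the configuration determinant by Cauchy-Binet: the coefficient of
   the product of the A_e over a set S of edges is the squared minor of a basis
   of H_1(G, p) on the columns in S. If this minor is nonzero, restriction to S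
   is an isomorphism on H_1(G, p), and inverting it exhibits the complement of
   S as a spanning forest without one edge. Conversely, let the complement of S
   be a quasi-spanning forest F with exceptional component T. The signed
   indicator d of the edges that leave T vanishes on F, and pairs with a chain
   to the mass of its boundary on T, which is 0 on H_1(G) and m_T(p) on q. By
   Cramer's rule the minor is, up to sign, m_T(p) times a minor of an integral
   basis of H_1(G) on the complement of a spanning forest; that one is 1 or -1
   because the fundamental cycles are another integral basis. *)

(** * Gram determinants *)

(* Cauchy-Binet. The squared maximal minors of [u] are given as a function [c]
   of the set of chosen columns, so that no ordering of the columns has to be
   fixed. *)
Lemma det_gram (R : comNzRingType) (I : finType) n (u : 'I_n -> I -> R)
    (a : I -> R) (c : {set I} -> R) :
  (forall g : 'I_n -> I, injective g ->
     \det (\matrix_(i, j) u i (g j)) ^+ 2 = c [set g i | i : 'I_n]) ->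
  (forall S : {set I}, #|S| != n -> c S = 0) ->
  \det (\matrix_(i, j) \sum_e a e * u i e * u j e) =
    \sum_S c S * \prod_(e in S) a e.
Proof.
move=> c_det c0.
(* Each row is a sum over the columns [e]; by multilinearity, [f] picks the summand taken in each
   row. *)
pose term (f : {ffun 'I_n -> I}) := \prod_i (a (f i) * u i (f i)) *
  \det (\matrix_(i, j) u j (f i)).
have -> : \det (\matrix_(i, j) \sum_e a e * u i e * u j e) = \sum_f term f.
  rewrite /determinant.
  under eq_bigr => s _.
    under eq_bigr do rewrite mxE.
    rewrite bigA_distr_bigA mulr_sumr /=.
    under eq_bigr do rewrite big_split /= mulrCA.
  over.
  rewrite exchange_big; apply: eq_bigr => f _.
  rewrite -mulr_sumr; congr (_ * _); apply: eq_bigr => s _.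
  by congr (_ * _); apply: eq_bigr => i _; rewrite mxE.
rewrite (bigID (fun f : {ffun 'I_n -> I} => injectiveb f)) /= addrC big1 ?add0r.
  rewrite (partition_big (fun f : {ffun 'I_n -> I} => [set f i | i : 'I_n]) xpredT) //=.
  apply: eq_bigr => S _; have [cardS|cardS] := eqVneq #|S| n; last first.
    rewrite c0 // mul0r big1 // => f /andP[/injectiveP injf /eqP imf].
    by case/eqP: cardS; rewrite -imf card_imset // card_ord.
  pose g i := enum_val (cast_ord (esym cardS) i).
  have injg : injective g by move=> i j /enum_val_inj/cast_ord_inj.
  have img : [set g i | i : 'I_n] = S.
    apply/setP => e; apply/imsetP/idP => [[i _ ->]|eS]; first exact: enum_valP.
    exists (cast_ord cardS (enum_rank_in eS e)) => //.
    by rewrite /g cast_ordK enum_rankK_in.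
  (* The injective [f] with image [S] are the fixed enumeration [g] of [S] precomposed with a
     permutation. *)
  pose G (s : {perm 'I_n}) := [ffun i => g (s i)].
  have injG : {in [set: {perm 'I_n}] &, injective G}.
    move=> s r _ _ /ffunP eqG; apply/permP => i.
    by have := eqG i; rewrite !ffunE => /injg.
  rewrite (eq_bigl (mem [set G s | s in [set: {perm 'I_n}]])) => [|f]; last first.
    apply/andP/imsetP => [[/injectiveP injf /eqP imf] | [s _ ->]].
      have /fin_all_exists[r rP] i : exists j, f i = g j.
        have : f i \in [set g i | i : 'I_n] by rewrite img -imf imset_f.
        by case/imsetP=> j _; exists j.
      have injr : injective r by move=> i j eqr; apply: injf; rewrite !rP eqr.
      by exists (perm injr) => //; apply/ffunP => i; rewrite ffunE permE.
    have injGs : injective (G s) by move=> i j; rewrite !ffunE => /injg/perm_inj.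
    split; first exact/injectiveP.
    rewrite eqEcard [X in (_ <= X)%N]card_imset // -img [X in (X <= _)%N]card_imset //.
    rewrite leqnn andbT; apply/subsetP => _ /imsetP[i _ ->].
    by rewrite ffunE imset_f.
  rewrite big_imset //= -img -c_det // big_imset /=; last by move=> ? ? _ _ /injg.
  (* Only one of the two equal determinants is expanded; in [term], the sign of [s] comes from
     permuting the rows of the other one. *)
  rewrite mulrC expr2 mulrA {2}/determinant mulr_sumr.
  rewrite (eq_bigl xpredT) => [|s]; last by rewrite inE.
  apply: eq_bigr => s _; rewrite /term big_split /= -!mulrA; congr (_ * _).
    rewrite [RHS](reindex_inj (@perm_inj _ s)).
    by apply: eq_bigr => i _; rewrite ffunE.
  rewrite mulrC mulrA; congr (_ * _); last first.
    by apply: eq_bigr => i _; rewrite mxE ffunE.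
  rewrite mulrC -det_perm -[X in _ * X]det_tr -det_mulmx -row_permE.
  by congr (\det _); apply/matrixP => i j; rewrite !mxE ffunE.
move=> f /injectivePn[i [j ij fij]].
rewrite /term (determinant_alternate ij) ?mulr0 // => k.
by rewrite !mxE fij.
Qed.

(** * Configuration determinants under a change of basis *)

Section ConfigDet.

Variables (K : fieldType) (E : finType).
Implicit Types (w : seq {ffun E -> K^o}) (n : nat).

Lemma config_detE n w : size w = n ->
  config_det w = \det (\matrix_(i < n, j < n)
    \sum_e (w`_i e * w`_j e : K) *: 'X_(enum_rank e)).
Proof. by move=> <-. Qed.

(** The weighted Gram matrix of [w] is [P A P^T], where [A] is that of [w']. *)
Lemma config_det_mulmx n w w' (P : 'M[K]_n) : size w = n -> size w' = n ->
  (forall i : 'I_n, w`_i = \sum_(j < n) P i j *: w'`_j) ->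
  config_det w = (\det P ^+ 2) *: config_det w'.
Proof.
move=> sw sw' wE; rewrite (config_detE sw) (config_detE sw').
set A := (X in _ *: \det X); pose Q := map_mx (@mpolyC #|E| K) P.
rewrite (_ : (\matrix_(i, j) _) = Q *m A *m Q^T).
  by rewrite !det_mulmx det_tr det_map_mx -mul_mpolyC rmorphXn mulrAC expr2.
apply/matrixP => i j; rewrite !mxE.
under [RHS]eq_bigr => l _.
  rewrite !mxE mulr_suml.
  under eq_bigr => k _ do rewrite !mxE mulr_sumr mulr_suml.
  over.
have wEe l e : w`_(l : 'I_n) e = \sum_k P l k * w'`_k e.
  by rewrite wE sum_ffunE; apply: eq_bigr => k _; rewrite ffunE.
under [LHS]eq_bigr do rewrite !wEe big_distrlr scaler_suml /=.
rewrite exchange_big /= [RHS]exchange_big; apply: eq_bigr => k _ /=.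
under eq_bigr do rewrite scaler_suml.
rewrite exchange_big; apply: eq_bigr => l _; apply: eq_bigr => e _ /=.
rewrite mul_mpolyC [RHS]mulrC mul_mpolyC !scalerA; congr (_ *: _).
by rewrite mulrACA [P i k * _]mulrC.
Qed.

Lemma perm_config_det w w' : perm_eq w w' -> config_det w = config_det w'.
Proof.
move=> /[dup] /perm_size sw /(@tuple_permP _ _ _ (in_tuple w'))[s wE].
rewrite (config_det_mulmx (P := perm_mx s) sw erefl) => [|i].
  by rewrite det_perm sqrr_sign scale1r.
rewrite wE -tnth_nth tnth_mktuple (tnth_nth 0) /=.
rewrite (bigD1 (s i)) //= big1 ?addr0 => [|j ji].
  by rewrite !mxE eqxx scale1r.
by rewrite !mxE eq_sym (negbTE ji) scale0r.
Qed.

(** The scalar is the squared determinant of the transition matrix. *)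
Lemma basis_config_det (W : {vspace {ffun E -> K^o}}) w w' :
  basis_of W w -> basis_of W w' ->
  exists2 c : K, c != 0 & config_det w = c *: config_det w'.
Proof.
move=> bw bw'; have sw' := vector.size_basis (X := in_tuple w') bw'.
have sw := vector.size_basis (X := in_tuple w) bw; move: sw'; rewrite sw => sw'.
have inW i : (i < size w)%N -> w`_i \in W by move=> iw; rewrite (basis_mem bw) ?mem_nth.
have inW' i : (i < size w')%N -> w'`_i \in W by move=> iw; rewrite (basis_mem bw') ?mem_nth.
have tw' : size w' == size w by rewrite sw'.
pose u := in_tuple w; pose u' := Tuple tw'.
pose P : 'M[K]_(size w) := \matrix_(i, j) coord u' j w`_i.
pose P' : 'M[K]_(size w) := \matrix_(i, j) coord u j w'`_i.
have PE (i : 'I_(size w)) : w`_i = \sum_(j < size w) P i j *: w'`_j.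
  rewrite {1}(coord_basis (X := u') bw' (inW i (ltn_ord i))).
  by apply: eq_bigr => j _; rewrite mxE.
have PE' (i : 'I_(size w)) : w'`_i = \sum_(j < size w) P' i j *: w`_j.
  have iw : (i < size w')%N by rewrite -sw'.
  rewrite {1}(coord_basis (X := u) bw (inW' i iw)).
  by apply: eq_bigr => j _; rewrite mxE.
have PP' : P *m P' = 1%:M.
  apply/matrixP => i j; rewrite !mxE.
  rewrite -(coord_free i j (basis_free (X := u) bw)).
  rewrite [u`_i]PE linear_sum; apply: eq_bigr => l _.
  by rewrite linearZ [P' l j]mxE.
exists (\det P ^+ 2); last exact: config_det_mulmx.
rewrite sqrf_eq0 -unitfE; apply/unitrP; exists (\det P').
by rewrite mulrC -det_mulmx PP' det1.
Qed.

End ConfigDet.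

(** * Forests and cuts *)

Lemma eq_set2 (X : finType) (a b c d : X) : [set a; b] = [set c; d] ->
  (a = c /\ b = d) \/ (a = d /\ b = c).
Proof.
move=> eq2; have mem x : (x == a) || (x == b) = (x == c) || (x == d).
  by have := erefl (x \in [set a; b]); rewrite {2}eq2 !inE.
move: (mem a) (mem b) (mem c) (mem d); rewrite !eqxx ?orbT /=.
do 2![case/esym/orP=> /eqP ?]; do 2![case/orP=> /eqP ?]; subst; auto.
Qed.

Section Graph.

Variables (G : mgraph) (h t : edge G -> vertex G).
Hypothesis hO : orientation h t.
Local Notation V := (vertex G).
Local Notation E := (edge G).
Implicit Types (F : {set E}) (e : E) (u v : V) (T : {set V}).

Lemma adj_edge F e : e \in F -> adj F (h e) (t e).
Proof. by move=> eF; apply/exists_inP; exists e; rewrite // hO. Qed.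

Lemma adjP F u v : adj F u v ->
  exists2 e, e \in F & (h e = u /\ t e = v) \/ (h e = v /\ t e = u).
Proof. by case/exists_inP=> e eF /eqP; rewrite hO => /eq_set2; exists e. Qed.

Lemma adj_sym F : ssrbool.symmetric (adj F).
Proof. by move=> u v; apply: eq_existsb => e; rewrite setUC. Qed.

Lemma connect_adj_sym F : connect_sym (adj F).
Proof. exact/sym_connect_sym/adj_sym. Qed.

Lemma connect_edge F e : e \in F -> connect (adj F) (h e) (t e).
Proof. by move=> eF; apply/connect1/adj_edge. Qed.

Lemma connect_adjS F F' : (forall e, e \in F -> connect (adj F') (h e) (t e)) ->
  forall u v, connect (adj F) u v -> connect (adj F') u v.
Proof.
move=> sFF'; apply: connect_sub => u v /adjP[e eF].
by case=> [[<- <-]|[<- <-]]; last rewrite connect_adj_sym; apply: sFF'.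
Qed.

(** Equivalently, [T] is a union of components of [F]. *)
Definition cut F T := forall e, e \in F -> (h e \in T) = (t e \in T).

Lemma cut_component F v : cut F (component F v).
Proof.
move=> e eF; rewrite !inE; apply/idP/idP => /connect_trans; apply.
  exact: connect_edge.
by rewrite connect_adj_sym connect_edge.
Qed.

Lemma cut_connect F T u v : cut F T -> connect (adj F) u v ->
  (u \in T) = (v \in T).
Proof.
move=> cFT; apply: closed_connect => {}u {}v /adjP[e eF].
by case=> [[<- <-]|[<- <-]]; rewrite cFT.
Qed.

Lemma componentS F F' v :
  (forall e, e \in F -> connect (adj F') (h e) (t e)) ->
  component F v \subset component F' v.
Proof. by move=> sFF'; apply/subsetP => u; rewrite !inE; apply: connect_adjS. Qed.

(** Components of [F] refine those of [G], and the two partitions agree once every edge of [G] stays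
    within one component of [F]. *)
Lemma components_eqP F :
  reflect (forall e, connect (adj F) (h e) (t e))
          (components F == components [set: E]).
Proof.
apply: (iffP eqP) => [eqF e | cF]; last first.
  apply: eq_imset => v; apply/eqP.
  by rewrite eqEsubset !componentS // => e _; rewrite connect_edge.
have /imsetP[v _ eqv] : component [set: E] (h e) \in components F.
  by rewrite eqF imset_f.
have : t e \in component F v by rewrite -eqv inE connect_edge.
have : h e \in component F v by rewrite -eqv inE connect0.
rewrite !inE connect_adj_sym; exact: connect_trans.
Qed.

(** * Forests as sets of bridges *)

Local Notation step := [rel x y : V * E | ends x.2 == [set x.1; y.1]].

(* The edges of a path of distinct vertices are distinct, since each one has an
   end that no later edge has. *)
Lemma path_edges F u s : path (adj F) u s -> uniq (u :: s) ->
  exists c : seq (V * E),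
  [/\ unzip1 c = belast u s, uniq (unzip2 c),
      forall x, x \in c -> (x.2 \in F) && (ends x.2 \subset u :: s)
    & forall x y e, ends x.2 = [set x.1; u] -> ends e = [set last u s; y.1] ->
      path step x (rcons (rcons c (last u s, e)) y)].
Proof.
elim: s u => [|v s IHs] u /=.
  move=> _ _; exists [::]; split=> //= x y e -> ->.
  by rewrite !eqxx.
case/andP=> /exists_inP[e0 e0F /eqP eqe0] Ps /andP[u_s uniqs].
have [c [c1 c2 cF Pc]] := IHs v Ps uniqs.
exists ((u, e0) :: c); split=> //= [|||x y e -> eqe].
- by rewrite c1.
- rewrite c2 andbT; apply/mapP => [[x /cF/andP[_ /subsetP sub] e0x]].
  by move: u_s; rewrite sub // -e0x eqe0 set21.
- move=> x; rewrite inE => /predU1P[-> | /cF /andP[-> sub]] /=.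
    rewrite e0F eqe0; apply/subsetP => z /set2P[]->; rewrite !inE eqxx ?orbT //.
  by apply: (subset_trans sub); apply/subsetP => z zs; rewrite inE zs orbT.
- by rewrite eqxx /= Pc.
Qed.

Lemma path_connect F x c y : path step x (rcons c y) ->
  (forall z, z \in x :: c -> z.2 \in F) -> connect (adj F) x.1 y.1.
Proof.
elim: c x => [|z c IHc] x /=.
  rewrite andbT => /eqP eqx xF; apply/connect1/exists_inP.
  by exists x.2; rewrite ?eqx // xF ?mem_head.
case/andP=> /eqP eqx Pc xF; apply: (@connect_trans _ _ z.1).
  by apply/connect1/exists_inP; exists x.2; rewrite ?eqx // xF ?mem_head.
by apply: IHc => // z' z'c; rewrite xF // inE z'c orbT.
Qed.

Definition bridges F :=
  forall e, e \in F -> ~~ connect (adj (F :\ e)) (h e) (t e).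

(** A path that joins the ends of [e] and avoids [e] closes up with [e] to a cycle; conversely, the
    rest of a cycle bypasses its first edge. *)
Lemma forest_bridges F : reflect (bridges F) (forest F).
Proof.
apply: (iffP (forestP F)) => [acyc e eF | brF c].
  apply/negP => /connectP[s0 Ps0 eqs0].
  case/shortenP: Ps0 eqs0 => s Ps us _ eqs.
  have [c [c1 c2 cF Pc]] := path_edges Ps us.
  case/negP: (acyc (rcons c (t e, e))); apply/and5P; split.
  - by case: (c).
  - by rewrite /unzip1 map_rcons -/(unzip1 c) c1 eqs -lastI.
  - rewrite /unzip2 map_rcons rcons_uniq -/(unzip2 c) c2 andbT.
    by apply/mapP => [[x /cF/andP[+ _]] eqx]; rewrite -eqx !inE eqxx.
  - rewrite all_rcons /= eF; apply/allP => x /cF/andP[].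
    by rewrite !inE => /andP[].
  case eqc: (rcons c _) => [|a c']; first by case: (c) eqc.
  have a1 : a.1 = h e.
    have: unzip1 (a :: c') = h e :: s by rewrite -eqc /unzip1 map_rcons -/(unzip1 c) c1 eqs -lastI.
    by case.
  have := Pc (t e, e) a e; rewrite -eqs eqc a1 hO setUC => /(_ erefl erefl).
  by rewrite /= => /andP[].
apply/negP => /and5P[]; case: c => // -[v e] c _ _ /=.
case/andP=> e_c _ /andP[/= eF cF] Pc.
have cFe z : z \in c -> z.2 \in F :\ e.
  move=> zc; have /= zF := allP cF z zc; rewrite !inE zF andbT.
  by apply: contraNneq e_c => <-; apply: map_f.
(* The rest of the cycle leads from the other end [w] of [e] back to [v]; for a loop, [w] is [v]. *)
suff [w con ends_e] : exists2 w, connect (adj (F :\ e)) w v & ends e = [set v; w].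
  case/negP: (brF e eF); move/esym: ends_e; rewrite hO.
  by case/eq_set2=> [[<- <-]|[<- <-]] //; rewrite connect_adj_sym.
case: c {cF e_c} Pc cFe => [|x c] /=.
  by rewrite andbT => /eqP eqe _; exists v.
by case/andP=> /eqP eqe Pc cFe; exists x.1 => //; apply: (path_connect Pc).
Qed.

Lemma spanning_forestP F :
  reflect (bridges F /\ forall e, connect (adj F) (h e) (t e))
          (spanning_forest F).
Proof.
apply: (iffP andP) => [[/forest_bridges ? /components_eqP ?] | [? ?]] //.
by split; [apply/forest_bridges | apply/components_eqP].
Qed.

(** Take the fewest edges that give the components of [G]: an edge that is not a bridge could still
    be deleted. *)
Lemma exists_spanning_forest : exists F, spanning_forest F.
Proof.
have spT : components [set: E] == components [set: E] by [].
case: (@arg_minnP _ [set: E] (fun F => components F == components [set: E])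
  (fun F : {set E} => #|F|) spT) => F /components_eqP cF minF.
exists F; apply/spanning_forestP; split=> // e eF; apply/negP => con_e.
have /minF : components (F :\ e) == components [set: E].
  apply/components_eqP => f; apply: connect_adjS (cF f) => g gF.
  have [-> //|ge] := eqVneq g e.
  by apply: connect_edge; rewrite !inE ge.
by rewrite (cardsD1 e F) eF ltnn.
Qed.

(** * Cycles and boundaries *)

Section Cycles.

Variable R : comNzRingType.
Implicit Types (x y z : {ffun E -> R}).
Local Notation "'d x" := (boundary h t x) (at level 10, x at level 8).

(** Discrete Stokes formula: only the edges that cross the border of [T] contribute. *)
Lemma sum_boundary x T : \sum_(v in T) 'd x v =
  \sum_e x e * ((h e \in T)%:R - (t e \in T)%:R).
Proof.
have sum_eq u : \sum_(v in T) (u == v)%:R = (u \in T)%:R :> R.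
  rewrite big_mkcond (bigD1 u) //= eqxx big1 ?addr0; first by case: (u \in T).
  by move=> v /negbTE; rewrite eq_sym => ->; rewrite if_same.
under eq_bigr do rewrite ffunE.
rewrite exchange_big; apply: eq_bigr => e _.
by rewrite -mulr_sumr sumrB !sum_eq.
Qed.

Lemma boundaryD x y : 'd (x + y) = 'd x + 'd y.
Proof.
apply/ffunP => v; rewrite !ffunE -big_split; apply: eq_bigr => e _.
by rewrite ffunE mulrDl.
Qed.

Lemma boundary0 : 'd (0 : {ffun E -> R}) = 0.
Proof.
by apply/ffunP => v; rewrite !ffunE big1 // => e _; rewrite ffunE mul0r.
Qed.

Lemma boundaryN x : 'd (- x) = - 'd x.
Proof.
by apply/eqP; rewrite -subr_eq0 opprK -boundaryD addNr boundary0.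
Qed.

Lemma boundary_sum (I : finType) (c : I -> R) (x : I -> {ffun E -> R}) :
  'd [ffun e => \sum_i c i * x i e] = [ffun v => \sum_i c i * 'd (x i) v].
Proof.
apply/ffunP => v; rewrite !ffunE; under eq_bigr do rewrite ffunE mulr_suml.
rewrite exchange_big; apply: eq_bigr => i _; rewrite ffunE mulr_sumr.
by apply: eq_bigr => e _; rewrite mulrA.
Qed.

Definition supported x F := forall e, e \notin F -> x e = 0.

(* Evaluate the boundary on the side of the cut that a bridge defines. *)
Lemma bridges_boundary_inj F x : bridges F -> supported x F -> 'd x = 0 -> x = 0.
Proof.
move=> brF xF dx0; apply/ffunP => e; rewrite ffunE.
have [eF|/xF//] := boolP (e \in F).
have := sum_boundary x (component (F :\ e) (h e)).
rewrite dx0 big1 => [|v _]; last by rewrite ffunE.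
(* No other edge of [F] crosses this cut, and [x] vanishes outside [F]. *)
rewrite (bigD1 e) //= big1 ?addr0 => [|f fe]; last first.
  have [fF|/xF->] := boolP (f \in F); last by rewrite mul0r.
  by rewrite (@cut_component (F :\ e)) ?subrr ?mulr0 // !inE fe.
by rewrite !inE connect0 (negbTE (brF e eF)) subr0 mulr1.
Qed.

Definition edge_chain e : {ffun E -> R} := [ffun f => (f == e)%:R].

Lemma boundary_edge e :
  'd (edge_chain e) = [ffun v => (h e == v)%:R - (t e == v)%:R].
Proof.
apply/ffunP => v; rewrite !ffunE (bigD1 e) //= ffunE eqxx mul1r.
by rewrite big1 ?addr0 // => f /negbTE fe; rewrite ffunE fe mul0r.
Qed.

(** The chain is the sum of the edges of a path, signed by the direction in which they are
    traversed. *)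
Lemma connect_boundary F u v : connect (adj F) u v -> exists x,
  supported x F /\ 'd x = [ffun a => (u == a)%:R - (v == a)%:R].
Proof.
case/connectP=> s Ps ->; elim: s u Ps => [|w s IHs] u /=.
  move=> _; exists 0; split=> [e _|]; first by rewrite ffunE.
  by rewrite boundary0; apply/ffunP => a; rewrite !ffunE subrr.
case/andP=> /adjP[e eF ends_e] /IHs[x [xF dx]].
have yF f : f \notin F -> edge_chain e f = 0.
  by move=> fF; rewrite ffunE (negbTE (contraNneq _ fF)) // => ->.
case: ends_e => [[eqh eqt]|[eqh eqt]].
  exists (edge_chain e + x); split=> [f fF|]; first by rewrite ffunE yF // xF // addr0.
  by rewrite boundaryD boundary_edge dx; apply/ffunP => a; rewrite !ffunE eqh eqt subrKA.
exists (x - edge_chain e); split=> [f fF|]; first by rewrite ffunE xF // ffunE yF // subr0.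
rewrite boundaryD boundaryN boundary_edge dx; apply/ffunP => a.
by rewrite !ffunE eqh eqt opprB addrC subrKA.
Qed.

(** The fundamental cycle of the chord [e]: subtract from [e] a path in [F] between its ends. *)
Lemma chord_cycle F e : e \notin F -> connect (adj F) (h e) (t e) ->
  exists z, 'd z = 0 /\ forall f, f \notin F -> z f = (f == e)%:R.
Proof.
move=> eF /connect_boundary[x [xF dx]].
exists (edge_chain e - x); split=> [|f fF]; last first.
  by rewrite !ffunE xF // subr0.
by rewrite boundaryD boundaryN boundary_edge dx subrr.
Qed.

(** Converse of [bridges_boundary_inj]: an edge that is not a bridge is a chord of the remaining
    edges, and its fundamental cycle is nonzero. *)
Lemma acyclic_bridges F :
  (forall x, supported x F -> 'd x = 0 -> x = 0) -> bridges F.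
Proof.
move=> injF e eF; apply/negP => /chord_cycle[|z [dz zF]]; first by rewrite !inE eqxx.
have: z e = 1 by rewrite zF ?eqxx // !inE eqxx.
rewrite (injF z) // => [/eqP|f fF]; first by rewrite ffunE eq_sym oner_eq0.
rewrite zF ?inE ?(negbTE fF) ?andbF //.
by rewrite (negbTE (contraNneq _ fF)) // => ->.
Qed.

(** Carry the mass of each vertex along a path to the root of its component; the total that arrives
    there is 0. *)
Lemma momentum_boundary (p : {ffun V -> R}) :
  (forall T, T \in components [set: E] -> \sum_(v in T) p v = 0) ->
  exists q, 'd q = p.
Proof.
move=> p0; pose r := fingraph.root (adj [set: E]).
have /fin_all_exists[x dx] v : exists x, 'd x = [ffun a => (v == a)%:R - (r v == a)%:R].
  by have [x [_ dx]] := connect_boundary (connect_root (adj [set: E]) v); exists x.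
exists [ffun e => \sum_v p v * x v e]; rewrite boundary_sum.
apply/ffunP => a; rewrite ffunE.
under eq_bigr do rewrite dx ffunE mulrBr.
rewrite sumrB (bigD1 a) //= eqxx mulr1 big1 ?addr0 => [|v /negbTE->]; last by rewrite mulr0.
rewrite [X in _ - X](_ : _ = 0) ?subr0 //.
have [ra|ra] := eqVneq (r a) a; last first.
  rewrite big1 // => v _; have [rva|] := eqVneq (r v) a; last by rewrite mulr0.
  by case/eqP: ra; rewrite -rva /r root_root //; apply: connect_adj_sym.
rewrite -[RHS](p0 (component [set: E] a)) ?imset_f // [RHS]big_mkcond.
apply: eq_bigr => v _; rewrite inE -(root_connect (@connect_adj_sym _)) -/r.
by rewrite -/(r a) ra eq_sym; case: eqP => _; rewrite (mulr1, mulr0).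
Qed.

End Cycles.

(** * Integral bases of the cycle space *)

(** The difference is a cycle supported on the forest. Values on the chords thus serve as
    coordinates of cycles. *)
Lemma spanning_cycle_inj (R : comNzRingType) F (x y : {ffun E -> R}) :
  spanning_forest F -> boundary h t x = 0 -> boundary h t y = 0 ->
  (forall e, e \notin F -> x e = y e) -> x = y.
Proof.
case/spanning_forestP=> brF _ dx dy eq_xy; apply/eqP; rewrite -subr_eq0.
apply/eqP/(bridges_boundary_inj brF) => [e /eq_xy eqe|].
  by rewrite !ffunE eqe subrr.
by rewrite boundaryD boundaryN dx dy subrr.
Qed.

Lemma ffunMzE (I : finType) (f : {ffun I -> int}) (n : int) i :
  (f *~ n) i = f i * n.
Proof.
by case: n => n; rewrite ?NegzE ?mulrNz ?mulrN ?ffunE ffunMnE -mulrzz.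
Qed.

Section Chords.

Variables (F : {set E}) (m : nat) (g : 'I_m -> E).
Hypotheses (spanF : spanning_forest F) (injg : injective g)
  (im_g : [set g i | i : 'I_m] = ~: F).

Let gF i : g i \notin F.
Proof. by have : g i \in ~: F by [rewrite -im_g imset_f]; rewrite inE. Qed.

Let gP e : e \notin F -> exists i, e = g i.
Proof. by rewrite -in_setC -im_g => /imsetP[i _ ->]; exists i. Qed.

Lemma fundamental_cycles : exists z : 'I_m -> {ffun E -> int},
  (forall i, boundary h t (z i) = 0) /\ forall i j, z i (g j) = (i == j)%:R.
Proof.
have [_ conF] := spanning_forestP _ spanF.
have /fin_all_exists[z zP] i : exists z : {ffun E -> int},
    boundary h t z = 0 /\ forall j, z (g j) = (i == j)%:R.
  have [z [dz zF]] := chord_cycle int (gF i) (conF (g i)).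
  by exists z; split=> // j; rewrite zF // (inj_eq injg) eq_sym.
by exists z; split=> i; have [] := zP i.
Qed.

(** The fundamental cycles form a basis: the coefficient of a cycle at [z j] is its value on the
    chord [g j]. *)
Lemma exists_integral_H1_basis :
  exists b : m.-tuple {ffun E -> int}, integral_H1_basis h t b.
Proof.
have [z [dz zg]] := fundamental_cycles.
have sum_zg c j : (\sum_i tnth [tuple z i | i < m] i *~ c i) (g j) = c j.
  rewrite sum_ffunE (bigD1 j) //= big1 => [|i ij].
    by rewrite tnth_mktuple ffunMzE zg eqxx mul1r addr0.
  by rewrite tnth_mktuple ffunMzE zg (negbTE ij) mul0r.
exists [tuple z i | i < m]; split=> [i|c c0 j|x dx].
- by rewrite tnth_mktuple.
- by rewrite -sum_zg c0 ffunE.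
exists (x \o g); apply: (spanning_cycle_inj spanF dx) => [|e /gP[j ->]].
  rewrite (_ : \sum_i _ = [ffun e => \sum_i x (g i) * z i e]); last first.
    apply/ffunP => e; rewrite sum_ffunE ffunE; apply: eq_bigr => i _.
    by rewrite tnth_mktuple ffunMzE mulrC.
  rewrite boundary_sum; apply/ffunP => v; rewrite !ffunE big1 // => i _.
  by rewrite dz ffunE mulr0.
by rewrite sum_zg.
Qed.

Variables (k : nat) (b : k.-tuple {ffun E -> int}).
Hypothesis bP : integral_H1_basis h t b.

Definition chord_matrix : 'M[int]_(k, m) := \matrix_(i, j) tnth b i (g j).

(** The chord matrix expresses [b] in the fundamental cycles, and [C] expresses these in [b]. Both
    inverse laws are stated, since [k] and [m] are not yet known to agree. *)
Lemma chord_matrix_inverse :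
  exists C, C *m chord_matrix = 1%:M /\ chord_matrix *m C = 1%:M.
Proof.
have [db freeb spanb] := bP; have [z [dz zg]] := fundamental_cycles.
have /fin_all_exists[c zE] j := spanb (z j) (dz j).
exists (\matrix_(j, i) c j i); split; apply/matrixP => i j; rewrite !mxE.
  rewrite -zg zE sum_ffunE; apply: eq_bigr => l _.
  by rewrite !mxE ffunMzE mulrC.
under eq_bigr do rewrite !mxE.
(* For fixed [i], the entries of row [i] of [chord_matrix *m C - 1] are the coefficients of a
   relation between the elements of [b]. *)
apply/eqP; rewrite -subr_eq0; apply/eqP; move: j; apply: freeb.
have bE : tnth b i = [ffun e => \sum_l tnth b i (g l) * z l e].
  apply: (spanning_cycle_inj spanF (db i)) => [|e /gP[j ->]].
    rewrite boundary_sum; apply/ffunP => v; rewrite !ffunE big1 // => l _.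
    by rewrite dz ffunE mulr0.
  rewrite ffunE (bigD1 j) //= zg eqxx mulr1 big1 ?addr0 // => l /negbTE lj.
  by rewrite zg lj mulr0.
apply/ffunP => e; rewrite sum_ffunE ffunE.
under eq_bigr do rewrite ffunMzE mulrBr mulr_sumr.
rewrite sumrB exchange_big /= [X in _ - X](bigD1 i) //= eqxx mulr1.
rewrite [X in _ - (_ + X)]big1 ?addr0 => [|j /negbTE ji]; last first.
  by rewrite eq_sym ji mulr0.
rewrite {2}bE ffunE -sumrB big1 // => l _.
rewrite zE sum_ffunE mulr_sumr -sumrB big1 // => j _.
by rewrite ffunMzE mulrCA subrr.
Qed.

Lemma card_chords : m = k.
Proof.
have [C [CB BC]] := chord_matrix_inverse.
by apply/eqP; rewrite eqn_leq (mulmx1_min CB) (mulmx1_min BC).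
Qed.

End Chords.

(** * Passage from integral cycles to chains over [K] *)

Section Basis.

Variable K : fieldType.
Implicit Types (p : {ffun V -> K^o}) (x q : {ffun E -> K^o}).

Lemma boundary_of_integral (z : {ffun E -> int}) v :
  boundary h t (of_integral K z) v = (boundary h t z v)%:~R.
Proof.
rewrite !ffunE rmorph_sum; apply: eq_bigr => e _.
by rewrite ffunE rmorphM rmorphB !rmorph_nat.
Qed.

Lemma chord_enum F :
  [set enum_val i | i : 'I_#|~: F|] = ~: F.
Proof.
apply/setP => e; apply/imsetP/idP => [[i _ ->]|eF]; first exact: enum_valP.
by exists (enum_rank_in eF e); rewrite // enum_rankK_in.
Qed.

Section IntegralBasis.

Variables (k : nat) (b : k.-tuple {ffun E -> int}).
Hypothesis bP : integral_H1_basis h t b.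

Let db i : boundary h t (of_integral K (tnth b i)) = 0.
Proof.
have [db0 _ _] := bP; apply/ffunP => v.
by rewrite boundary_of_integral db0 !ffunE.
Qed.

(** Evaluated on the chords, a relation is a row killed by the chord matrix, whose invertibility
    over the integers persists over [K] in any characteristic. *)
Lemma of_integral_free (c : 'I_k -> K) :
  \sum_i c i *: of_integral K (tnth b i) = 0 -> forall i, c i = 0.
Proof.
move=> c0; have [F spanF] := exists_spanning_forest.
have [C [_ BC]] := chord_matrix_inverse spanF enum_val_inj (chord_enum F) bP.
pose r := \row_i c i.
have rB : r *m map_mx intr (chord_matrix (@enum_val _ (~: F)) b) = 0.
  apply/matrixP => i j; rewrite !mxE.
  move/ffunP/(_ (enum_val j)): c0; rewrite sum_ffunE ffunE => c0.
  rewrite -[RHS]c0; apply: eq_bigr => l _; by rewrite !mxE !ffunE.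
have /rowP r0 : r = 0.
  by rewrite -[r]mulmx1 -(map_mx1 intr) -BC map_mxM mulmxA rB mul0mx.
by move=> i; have := r0 i; rewrite !mxE.
Qed.

Lemma of_integral_span x : boundary h t x = 0 ->
  exists c : 'I_k -> K, x = \sum_i c i *: of_integral K (tnth b i).
Proof.
move=> dx; have [F spanF] := exists_spanning_forest.
have [C [CB _]] := chord_matrix_inverse spanF enum_val_inj (chord_enum F) bP.
(* The values of [x] on the chords, converted by [C] into coordinates in [b]. *)
pose r := \row_j x (@enum_val _ (mem (~: F)) j) *m map_mx intr C.
exists (fun i => r 0 i); apply: (spanning_cycle_inj spanF dx).
  rewrite linear_sum big1 // => i _; by rewrite linearZ /= db scaler0.
move=> e; rewrite -in_setC -(chord_enum F) => /imsetP[j _ ->].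
have : (r *m map_mx intr (chord_matrix (@enum_val _ (~: F)) b)) 0 j = x (enum_val j).
  by rewrite /r -mulmxA -map_mxM CB map_mx1 mulmx1 mxE.
move=> <-; rewrite mxE sum_ffunE; apply: eq_bigr => i _.
by rewrite !mxE !ffunE.
Qed.

(** The boundary map sends [q] to [p != 0] and kills the cycles, so it isolates the coefficient of
    [q]. *)
Lemma relative_H1_basis p q : p != 0 -> boundary h t q = p ->
  basis_of (relative_H1 h t p) (q :: [seq of_integral K z | z <- b]).
Proof.
move=> p0 dq; pose X := [tuple of q :: [seq of_integral K z | z <- b]].
have X0 : X`_(ord0 : 'I_k.+1) = q by [].
have XS (i : 'I_k) : X`_(lift ord0 i) = of_integral K (tnth b i).
  by rewrite (tnth_nth 0) /= add0n (nth_map 0) ?size_tuple.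
apply/andP; split; last first.
  apply/(@freeP _ _ _ X) => c; rewrite big_ord_recl X0.
  under eq_bigr do rewrite XS.
  move=> sum0; have c0 : c ord0 = 0.
    have := congr1 (boundary h t) sum0.
    rewrite linear0 linearD linearZ /= dq linear_sum big1 ?addr0 => [|i _].
      by move/eqP; rewrite scaler_eq0 (negbTE p0) orbF => /eqP.
    by rewrite linearZ /= db scaler0.
  move: sum0; rewrite c0 scale0r add0r => /of_integral_free cS i.
  by case: (unliftP ord0 i) => [j|] ->.
rewrite eqEsubv; apply/andP; split.
  apply/span_subvP => x; rewrite inE => /predU1P[->|/mapP[z /tnthP[i ->] ->]].
    by apply/relative_H1P; exists 1; rewrite scale1r.
  by apply/relative_H1P; exists 0; rewrite db scale0r.
apply/subvP => x /relative_H1P[a dx].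
have /of_integral_span[c xE] : boundary h t (x - a *: q) = 0.
  by rewrite linearB linearZ /= dq dx subrr.
rewrite -(subrK (a *: q) x) xE; apply: rpredD; last first.
  by rewrite rpredZ // memv_span // mem_head.
apply: rpred_sum => i _; rewrite rpredZ // memv_span // inE map_f ?orbT //.
exact: mem_tnth.
Qed.

End IntegralBasis.

(** * Minors of a basis of H_1(G, p) *)

Lemma quasi_spanning_forestP F :
  reflect (exists2 e, e \notin F & spanning_forest (e |: F))
          (quasi_spanning_forest F).
Proof.
apply: (iffP existsP) => [[F' /exists_inP[e eF' /andP[spF' /eqP->]]]|[e eF sp]].
  by exists e; rewrite ?setD1K // !inE eqxx.
exists (e |: F); apply/exists_inP; exists e; first exact: setU11.
by rewrite sp setU1K //=.
Qed.

(** The edge [e] leaves this component, being a bridge of [e |: F]. Hence the [pick] in [sqmass]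
    succeeds. *)
Lemma exceptional_component F e : e \notin F -> spanning_forest (e |: F) ->
  component F (h e) \in exceptional F.
Proof.
move=> eF /spanning_forestP[/(_ e) br _].
rewrite inE imset_f // andbT; apply/imsetP => [[u _ eq_c]].
have : h e \in component F (h e) by rewrite inE connect0.
rewrite eq_c (cut_component u (in_setT e)) -eq_c inE -{1}(setU1K eF).
by apply/negP/br; apply: setU11.
Qed.

(** If [e] did not cross [T], no edge of the spanning forest would, hence no edge of [G], and [T]
    would be a component of [G]. *)
Lemma exceptional_cut F e T : e \notin F -> spanning_forest (e |: F) ->
  T \in exceptional F -> cut F T /\ (h e \in T) != (t e \in T).
Proof.
move=> eF /spanning_forestP[_ con]; rewrite inE => /andP[nT /imsetP[v _ defT]].
have cFT : cut F T by rewrite defT; apply: cut_component.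
split=> //; apply: contra nT => /eqP eqT.
have cT : cut [set: E] T.
  move=> f _; apply: cut_connect (con f) => g; rewrite !inE.
  by case/predU1P=> [->|/cFT].
apply/imsetP; exists v => //; apply/eqP; rewrite eqEsubset {1}defT.
apply/andP; split; first by apply: componentS => f fF; apply: connect_edge.
apply/subsetP => u; rewrite inE => /(cut_connect cT) <-.
by rewrite defT inE connect0.
Qed.

Section Minors.

Variables (p : {ffun V -> K^o}) (q : {ffun E -> K^o}).
Hypotheses (p0 : p != 0) (dq : boundary h t q = p).
Variables (k : nat) (b : k.-tuple {ffun E -> int}).
Hypothesis bP : integral_H1_basis h t b.

Let w : k.+1.-tuple {ffun E -> K^o} :=
  [tuple of q :: [seq of_integral K z | z <- b]].

Let w0 : w`_(ord0 : 'I_k.+1) = q. Proof. by []. Qed.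

Let wS (i : 'I_k) : w`_(lift ord0 i) = of_integral K (tnth b i).
Proof. by rewrite (tnth_nth 0) /= add0n (nth_map 0) ?size_tuple. Qed.

Let w_basis : basis_of (relative_H1 h t p) w.
Proof. exact: relative_H1_basis. Qed.

Let dw (i : 'I_k.+1) : boundary h t w`_i = if i == ord0 then p else 0.
Proof.
case: (unliftP ord0 i) => [j|] ->; last by rewrite w0 eqxx.
have [db _ _] := bP; rewrite wS eq_sym (negbTE (neq_lift _ _)).
by apply/ffunP => v; rewrite boundary_of_integral db !ffunE.
Qed.

(** The complement consists of [e] and the [k] chords of the spanning forest [e |: F]. *)
Lemma card_quasi_spanning F : quasi_spanning_forest F -> #|~: F| = k.+1.
Proof.
case/quasi_spanning_forestP=> e eF sp.
rewrite -(card_chords sp enum_val_inj (chord_enum _) bP) (cardsD1 e) inE eF.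
by rewrite setCU setIC -setDE.
Qed.

Section Minor.

Variable g : 'I_k.+1 -> E.
Hypothesis injg : injective g.
Local Notation S := [set g i | i : 'I_k.+1].
Let M : 'M[K]_k.+1 := \matrix_(i, j) (w`_i (g j) : K).

Lemma minor_quasi_spanning : quasi_spanning_forest (~: S) ->
  \det M ^+ 2 = sqmass p (~: S).
Proof.
case/quasi_spanning_forestP=> e eF sp.
rewrite /sqmass; case: pickP => [T excT|/(_ (component (~: S) (h e)))]; last first.
  by rewrite exceptional_component.
have [cFT eT] := exceptional_cut eF sp excT.
have /imsetP[i0 _ def_e] : e \in S by move: eF; rewrite inE negbK.
pose d f : K := (h f \in T)%:R - (t f \in T)%:R.
have d0 f : f \notin S -> d f = 0.
  by move=> fS; rewrite /d cFT ?subrr // inE.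
have de : d e ^+ 2 = 1.
  rewrite /d; move: eT; case: (h e \in T); case: (t e \in T) => // _.
    by rewrite subr0 expr1n.
  by rewrite sub0r sqrrN expr1n.
(* By [sum_boundary], pairing with [d] gives the mass on [T] of the boundary; only the row of [q]
   has a nonzero boundary. *)
have Md : M *m (\col_j d (g j)) = \col_i ((i == ord0)%:R * mass p T).
  apply/colP => i; rewrite !mxE.
  have -> : (i == ord0)%:R * mass p T = \sum_(v in T) boundary h t w`_i v.
    rewrite dw; case: eqP => _; first by rewrite mul1r.
    by rewrite mul0r big1 // => v _; rewrite ffunE.
  rewrite (@sum_boundary K^o) (bigID (mem S)) /= [X in _ = _ + X]big1 ?addr0.
    rewrite big_imset /=; last by move=> ? ? _ _ /injg.
    by apply: eq_bigr => j _; rewrite !mxE.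
  by move=> f /d0; rewrite /d => ->; rewrite mulr0.
(* Cramer's rule at the index [i0] of [e]: [\det M * d e] is the mass of [T] times the cofactor at
   row [ord0], column [i0]. *)
have := congr1 (fun A : 'cV_k.+1 => (\adj M *m A) i0 ord0) Md.
rewrite mulmxA mul_adj_mx mul_scalar_mx !mxE -def_e.
rewrite (bigD1 ord0) //= big1 ?addr0 => [|j /negbTE j0]; last first.
  by rewrite !mxE j0 mul0r mulr0.
rewrite !mxE eqxx mul1r => /(congr1 (fun a : K => a ^+ 2)).
rewrite exprMn de mulr1 => ->; rewrite exprMn /cofactor exprMn.
rewrite sqrr_sign mul1r.
(* The remaining columns are the chords of the spanning forest, so the cofactor is, up to sign, the
   determinant of a chord matrix. *)
pose g' := g \o lift i0.
have injg' : injective g' by move=> i j /injg/lift_inj.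
have im_g' : [set g' i | i : 'I_k] = ~: (e |: ~: S).
  apply/setP => f; rewrite !inE negb_or negbK.
  apply/imsetP/andP => [[j _ ->]|[fe /imsetP[i _ def_f]]].
    split; last by rewrite /g' /= imset_f.
    by rewrite /g' /= def_e (inj_eq injg) eq_sym neq_lift.
  case: (unliftP i0 i) def_f => [j|] ->; first by exists j.
  by rewrite -def_e => eq_f; rewrite eq_f eqxx in fe.
have [C [_ BC]] := chord_matrix_inverse sp injg' im_g' bP.
have -> : row' ord0 (col' i0 M) = map_mx intr (chord_matrix g' b).
  by apply/matrixP => i j; rewrite !mxE wS ffunE.
rewrite det_map_mx -rmorphXn /=.
have : \det (chord_matrix g' b) \is a GRing.unit.
  by apply/unitrP; exists (\det C); rewrite mulrC -det_mulmx BC det1.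
(* A unit of [int] is 1 or -1. *)
by case/orP=> /eqP->; rewrite ?sqrrN expr1n mul1r.
Qed.

Lemma minor_neq0_quasi_spanning : \det M != 0 -> quasi_spanning_forest (~: S).
Proof.
rewrite -unitfE -[_ \is a _]/(M \in unitmx) => unitM.
have uniq0 x : x \in relative_H1 h t p -> (forall j, x (g j) = 0) -> x = 0.
  move/(coord_basis w_basis) => xE x0.
  pose c : 'rV[K]_k.+1 := \row_i coord w i x.
  have cM : c *m M = 0.
    apply/rowP => j; rewrite !mxE -[RHS](x0 j) [in RHS]xE sum_ffunE.
    by apply: eq_bigr => i _; rewrite !mxE ffunE.
  have /rowP c0 : c = 0 by rewrite -[c](mulmxK unitM) cM mul0mx.
  rewrite xE big1 // => i _; have := c0 i; rewrite !mxE => ->.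
  by rewrite scale0r.
(* The basis of H_1(G, p) dual to the coordinates on [S]. *)
pose y i := \sum_j invmx M i j *: w`_j.
have yH i : y i \in relative_H1 h t p.
  apply: rpred_sum => j _; rewrite rpredZ // (basis_mem w_basis) // mem_nth //.
  by rewrite size_tuple.
have yg i j : y i (g j) = (i == j)%:R.
  have /matrixP/(_ i j) := mulVmx unitM; rewrite !mxE => <-.
  by rewrite sum_ffunE; apply: eq_bigr => l _; rewrite !mxE ffunE.
(* Otherwise all of H_1(G, p), including [q], would consist of cycles. *)
have [i0 dy0] : exists i, boundary h t (y i) != 0.
  apply/existsP; apply: contraNT p0 => /existsPn dy0.
  have : q = \sum_i q (g i) *: y i.
    apply/eqP; rewrite -subr_eq0; apply/eqP/uniq0 => [|j].
      apply: rpredB; first by apply/relative_H1P; exists 1; rewrite scale1r.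
      by apply: rpred_sum => i _; rewrite rpredZ.
    rewrite !ffunE sum_ffunE (bigD1 j) //= ffunE yg eqxx big1 => [|i /negbTE ij].
      by rewrite addr0 [_ *: _]mulr1 subrr.
    by rewrite ffunE yg ij [_ *: _]mulr0.
  move=> qE; rewrite -dq qE linear_sum big1 // => i _.
  by rewrite linearZ /=; have := dy0 i; rewrite negbK => /eqP->; rewrite scaler0.
have [a dy] := relative_H1P _ _ _ _ (yH i0).
have a0 : a != 0 by apply: contraNneq dy0 => a0; rewrite dy a0 scale0r.
pose F' := g i0 |: ~: S.
have F'g j : (g j \in F') = (j == i0).
  by rewrite !inE imset_f // orbF (inj_eq injg).
have notF' e : e \notin F' -> exists2 j, e = g j & j != i0.
  rewrite !inE negb_or negbK => /andP[ei /imsetP[j _ def_e]].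
  by exists j => //; apply: contraNneq ei => <-; rewrite def_e.
apply/quasi_spanning_forestP; exists (g i0); first by rewrite inE negbK imset_f.
apply/spanning_forestP; split=> [|e].
  (* A cycle supported on [F'] vanishes on [S] except at [g i0], so it is a multiple of [y i0],
     whose boundary is nonzero. *)
  apply: (@acyclic_bridges K^o) => x xF dx.
  have xE : x = x (g i0) *: y i0.
    apply/eqP; rewrite -subr_eq0; apply/eqP/uniq0 => [|j].
      apply: rpredB; last by rewrite rpredZ.
      by apply/relative_H1P; exists 0; rewrite scale0r.
    rewrite !ffunE yg; have [<-|ji] := eqVneq i0 j.
      by rewrite [_ *: _]mulr1 subrr.
    by rewrite [_ *: _]mulr0 subr0 xF // F'g eq_sym.
  move: dx; rewrite xE linearZ /= dy scalerA => /eqP.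
  by rewrite scaler_eq0 (negbTE p0) orbF mulf_eq0 (negbTE a0) orbF => /eqP->; rewrite scale0r.
have [/connect_edge //|/notF'[j -> ji]] := boolP (e \in F').
have [c dyj] := relative_H1P _ _ _ _ (yH j).
(* Cancelling the boundaries gives a cycle that is 1 on [g j] and 0 on the other edges outside [F'].
   If [F'] did not join the ends of [g j], the boundary of [z] would have mass 1 on the component of
   [h (g j)]. *)
pose z := y j - (c / a) *: y i0.
have dz : boundary h t z = 0.
  by rewrite linearB linearZ /= dy dyj scalerA divfK // subrr.
have := @sum_boundary K^o z (component F' (h (g j))).
rewrite dz big1 => [|v _]; last by rewrite ffunE.
rewrite (bigD1 (g j)) //= big1 ?addr0 => [|f fj]; last first.
  have [fF|/notF'[l def_f li]] := boolP (f \in F').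
    by rewrite (cut_component _ fF) subrr mulr0.
  move: fj; rewrite def_f (inj_eq injg) => /negbTE lj.
  rewrite !ffunE !yg eq_sym lj [i0 == l]eq_sym (negbTE li).
  by rewrite [_ *: _]mulr0 subr0 mul0r.
rewrite !ffunE !yg eqxx [i0 == j]eq_sym (negbTE ji) [_ *: _]mulr0 subr0 mul1r.
rewrite !inE connect0; case: (connect _ _ _) => //.
by rewrite subr0 => /esym/eqP; rewrite oner_eq0.
Qed.

End Minor.

Lemma second_graph_poly_config_det : second_graph_poly p = config_det w.
Proof.
(* The value 0 is right for the other [S]: a nonzero minor would make the complement
   quasi-spanning. *)
pose c (S : {set E}) : K :=
  if quasi_spanning_forest (~: S) then sqmass p (~: S) else 0.
rewrite (config_detE (size_tuple w)).
have -> : \matrix_(i, j) (\sum_e (w`_i e * w`_j e : K) *: 'X_(enum_rank e)) =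
    \matrix_(i < k.+1, j < k.+1) \sum_e ('X_(enum_rank e) : {mpoly K[#|E|]})
      * (w`_i e)%:MP * (w`_j e)%:MP.
  apply/matrixP => i j; rewrite !mxE; apply: eq_bigr => e _.
  by rewrite -mul_mpolyC mpolyCM mulrC mulrA.
rewrite (@det_gram _ _ _ _ _ (fun S => (c S)%:MP)) => [|g injg|S cardS].
(* Columns [S] and forests [F] correspond by complement. *)
- rewrite [RHS](reindex_inj (@setC_inj _)) [LHS]big_mkcond /=.
  apply: eq_bigr => F _; rewrite /c setCK.
  case: ifP => _; last by rewrite mul0r.
  rewrite mul_mpolyC; congr (_ *: _); apply: eq_bigl => e.
  by rewrite inE.
- rewrite (_ : \matrix_(i, j) _ = map_mx (@mpolyC _ _)
    (\matrix_(i, j) (w`_i (g j) : K))); last by apply/matrixP => i j; rewrite !mxE.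
  rewrite det_map_mx -rmorphXn; congr (_%:MP); rewrite /c.
  case: ifPn => [/(minor_quasi_spanning injg)//|nq].
  apply/eqP; rewrite sqrf_eq0; apply: contraNT nq.
  exact: minor_neq0_quasi_spanning.
- rewrite /c; case: ifP => // /card_quasi_spanning; rewrite setCK => cS.
  by rewrite cS eqxx in cardS.
Qed.

End Minors.

End Basis.

End Graph.

Theorem proposition3p14 (K : fieldType) (G : mgraph)
    (h t : edge G -> vertex G) (p : {ffun vertex G -> K^o})
    (hO : orientation h t) (hp : momentum p) (hp0 : p != 0) :
  config_poly (relative_H1 h t p) (second_graph_poly p) /\
  (forall (k : nat) (b : k.-tuple {ffun edge G -> int})
          (q : {ffun edge G -> K^o}) (w : seq {ffun edge G -> K^o}),
     integral_H1_basis h t b -> boundary h t q = p ->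
     perm_eq w (q :: [seq of_integral K z | z <- b]) ->
     basis_of (relative_H1 h t p) w /\ second_graph_poly p = config_det w).
Proof.
split=> [|k b q w bP dq eq_w]; last first.
  rewrite (perm_basis _ eq_w) (perm_config_det eq_w).
  by split; [apply: relative_H1_basis | apply: second_graph_poly_config_det].
have [q dq] := momentum_boundary hO (R := K^o) hp.
split=> [|w bw Q].
  apply: contraNneq hp0 => W0; have : q \in relative_H1 h t p.
    by apply/relative_H1P; exists 1; rewrite scale1r.
  by rewrite W0 memv0 -dq => /eqP->; rewrite boundary0.
(* One integral basis suffices: any other basis of H_1(G, p) changes the determinant by a nonzero
   scalar, which generates the same ideal. *)
have [F spF] := exists_spanning_forest hO.
have [b bP] := exists_integral_H1_basis hO spF enum_val_inj (chord_enum _).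
rewrite (second_graph_poly_config_det hO hp0 dq bP).
have [c c0 ->] := basis_config_det bw (relative_H1_basis hO bP hp0 dq).
split=> [[a ->]|[a ->]].
  by exists (c^-1 *: a); rewrite -scalerAl -scalerAr scalerA mulVf // scale1r.
by exists (c *: a); rewrite -scalerAr -scalerAl.
Qed.
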